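(* Let $\chi_1,\chi_2$ be fixed primitive nontrivial Dirichlet characters modulo $q_1,q_2$ respectively, with $\chi_1\chi_2(-1)=1$. Let $c\ge1$ be an integer with $q_1q_2\mid c$, and put $c'=\frac{c}{q_2}$. Suppose $a=1+nc'$ and $d=1-mc'$ with $m,n\in\mathbb{Z}$ and $ad\equiv1\pmod c$. Then $$S_{\chi_1,\chi_2}(a,c)=\beta(\chi_1,\chi_2,m,n)\,c'+O(\log c'),$$ where $$\beta(\chi_1,\chi_2,m,n)=\frac{\tau(\overline{\chi_1})\,\tau(\overline{\chi_2})}{4\pi^2 i}\,L(2,\chi_1\chi_2)\Big((1+i)\chi_2(n)-(1-i)\chi_2(m)\,\overline{\chi_2}(d)\Big),$$ and the implied constant depends only on $q_1,q_2$.
   Context: For integers $a,c$ with $c\ge 1$, $\gcd(a,c)=1$ and $q_1q_2\mid c$, the newform Dedekind sum is $$S_{\chi_1,\chi_2}(a,c)=\sum_{j \bmod c}\ \sum_{n \bmod q_1}\overline{\chi_2}(j)\,\overline{\chi_1}(n)\,B_1\!\left(\frac{j}{c}\right)B_1\!\left(\frac{n}{q_1}+\frac{aj}{c}\right),$$ where $B_1(x)=x-\lfloor x\rfloor-\frac12$ if $x\in\mathbb{R}\setminus\mathbb{Z}$ and $B_1(x)=0$ if $x\in\mathbb{Z}$. For a Dirichlet character $\chi$ modulo $q$, $\tau(\chi)=\sum_{n\bmod q}\chi(n)e^{2\pi i n/q}$ is the Gauss sum. $L(2,\chi_1\chi_2)=\sum_{l=1}^\infty \frac{\chi_1(l)\chi_2(l)}{l^2}$,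 where $\chi_1\chi_2$ is the (possibly imprimitive) pointwise product. *)

(* Defs.v *)
From mathcomp Require Export all_boot all_order all_algebra.
From mathcomp Require Export complex.
From mathcomp Require Export all_classical all_reals all_analysis.

Set Implicit Arguments.
Unset Strict Implicit.
Unset Printing Implicit Defensive.

Import Order.TTheory GRing.Theory Num.Theory.
Import numFieldNormedType.Exports.

Local Open Scope classical_set_scope.
Local Open Scope ring_scope.
Local Open Scope complex_scope.

(* A Dirichlet character modulo q, as a function on the integers;
   chi 1 = 1 follows from the last two clauses. *)
Definition dirichlet_character (R : realType) (q : nat) (chi : int -> R[i]) :
    Prop :=
  [/\ (0 < q)%N,
      forall x : int, chi (x + q%:Z) = chi x,
      forall x y : int, chi (x * y) = chi x * chi y
    & forall x : int, (chi x != 0) = coprimez x q%:Z].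

Definition induced_by (R : realType) (q : nat) (chi psi : int -> R[i]) : Prop :=
  forall x : int, coprimez x q%:Z -> chi x = psi x.

Definition primitive_character (R : realType) (q : nat) (chi : int -> R[i]) :
    Prop :=
  dirichlet_character q chi /\
  forall (d : nat) (psi : int -> R[i]), (d %| q)%N -> (d < q)%N ->
    dirichlet_character d psi -> ~ induced_by q chi psi.

Definition nontrivial_character (R : realType) (q : nat) (chi : int -> R[i]) :
    Prop :=
  exists2 x : int, coprimez x q%:Z & chi x != 1.

Definition conj_character (R : realType) (chi : int -> R[i]) : int -> R[i] :=
  fun x => (chi x)^*.

Definition B1 (R : realType) (x : R) : R :=
  if x \is a Num.int then 0 else x - (Num.floor x)%:~R - 2^-1.

Definition dedekind_sum (R : realType) (q1 : nat) (chi1 chi2 : int -> R[i])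
    (a : int) (c : nat) : R[i] :=
  \sum_(j < c) \sum_(n < q1)
    (chi2 j%:Z)^* * (chi1 n%:Z)^* *
    (B1 (j%:R / c%:R : R) * B1 (n%:R / q1%:R + a%:~R * j%:R / c%:R : R))%:C.

Definition cexpi (R : realType) (t : R) : R[i] := cos t +i* sin t.

Definition gauss_sum (R : realType) (q : nat) (chi : int -> R[i]) : R[i] :=
  \sum_(n < q) chi n%:Z * cexpi (2 * pi * n%:R / q%:R).

(* [R[i]^o] carries the topology of the complex norm; the sum starts at
   l = 1, so the summand of index k is that of l = k.+1. *)
Definition L2 (R : realType) (chi1 chi2 : int -> R[i]) : R[i] :=
  lim (series (fun k : nat =>
    chi1 k.+1%:Z * chi2 k.+1%:Z / k.+1%:R ^+ 2 : R[i]^o) @ \oo).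

Definition beta (R : realType) (q1 q2 : nat) (chi1 chi2 : int -> R[i])
    (m n d : int) : R[i] :=
  gauss_sum q1 (conj_character chi1) * gauss_sum q2 (conj_character chi2)
    / ((4 * pi ^+ 2)%:C * 'i) * L2 chi1 chi2
  * ((1 + 'i) * chi2 n - (1 - 'i) * chi2 m * (chi2 d)^*).

(* Main.v *)
Require Import Defs.
From mathcomp Require Import cyclic ring lra zify.

Set Implicit Arguments.
Unset Strict Implicit.
Unset Printing Implicit Defensive.

Import Order.TTheory GRing.Theory Num.Theory.
Import numFieldNormedType.Exports.

Local Open Scope classical_set_scope.
Local Open Scope ring_scope.
Local Open Scope complex_scope.

(** Write [Q = q1 q2] and [c = Q N], so that [c' = q1 N].  The idea is that [S] is a
  Riemann sum.  Since [a j / c = j / c + n j / q2] and the sum of [conj chi1] over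
  a period vanishes, the inner sum over residues modulo [q1] is a step function of
  [j / c], shifted by [n j / q2], which is constant between consecutive multiples
  of [1 / Q].  Hence on each of the [Q] blocks [k N <= j < (k + 1) N] the summand
  is, apart from [j = k N], a function of [j] of period [q2] times the linear
  function [B1 (j / c)].  Summation by parts replaces the periodic factor by its
  mean with a bounded error ([sum_periodic_mean]), and all of [S] becomes
  [N / q2] times a quantity [dedekind_mean] that does not depend on [N], with an
  error bounded in terms of [q1] and [q2] only ([dedekind_sum_approx]).  The error
  is thus [O(1)], which is absorbed in [O(log c')] because [c' >= 2].

  [dedekind_mean] is a sum of correlations of the sawtooth [B1 ((k + 1/2) / Q)] on
  [Z / Q], twisted by [conj chi1] and [conj chi2].  Its discrete Fourier transform
  at [l] has squared modulus [1 / (4 sin^2 (pi l / Q))], so Parseval's identity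
  ([sawtooth_correlation]) turns the twists into Gauss sums at every frequency [l]
  ([dedekind_meanE]).  By primitivity these equal [chi1 l tau (conj chi1)] and
  [chi2 (n l) tau (conj chi2)] for all [l], units or not ([gauss_twistE]).  What is
  left is the finite sum of [chi1 chi2 (l) / sin^2 (pi l / Q)].

  That sum is [2 Q^2 / pi^2] times [L(2, chi1 chi2)] ([L2E]): by the duplication
  formula for [1 / sin^2] its value is [4^-n] times the same sum for the modulus
  [2^n Q], and since [1 / sin^2 y - 1 / y^2] lies in [[0, 1]] for
  [0 < y <= pi / 2], letting [n] grow turns cosecants into inverse squares; the
  evenness of [chi1 chi2] folds the two halves of the period together.

  Finally, [a d = 1] modulo [c] forces [chi2 n = chi2 m conj (chi2 d)], so the
  bracket in [beta] is [2 i chi2 n] ([beta_bracket]) and the two main terms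
  agree. *)

(** * Sums over residue systems *)

Lemma eqz_mod_dvdP (x y d : int) : (x = y %[mod d])%Z <-> (d %| x - y)%Z.
Proof. by rewrite -eqz_mod_dvd; split=> [->|/eqP]. Qed.

Lemma periodicz (V : zmodType) (F : int -> V) (q : int) :
  periodic F q -> forall k x, F (x + k * q) = F x.
Proof.
move=> Fq.
have Fn n x : F (x + n%:Z * q) = F x by rewrite -natz mulr_natl periodicn.
move=> [n|n] x; first exact: Fn.
by rewrite -(Fn n.+1) NegzE mulNr subrK.
Qed.

Lemma periodic_eqmod (V : zmodType) (F : int -> V) (q x y : int) :
  periodic F q -> (x = y %[mod q])%Z -> F x = F y.
Proof.
move=> Fq /eqz_mod_dvdP/dvdzP[k xy].
by rewrite -(periodicz Fq k y) -xy addrC subrK.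
Qed.

Lemma periodic_comp_affine (V : zmodType) (F : int -> V) (q s y : int) :
  periodic F q -> periodic (fun x => F (s + y * x)) q.
Proof. by move=> Fq x; rewrite mulrDr addrA periodicz. Qed.

Section ResidueSums.
Variables (V : zmodType) (F : int -> V) (q : nat).
Hypothesis (q_gt0 : (0 < q)%N) (Fq : periodic F q%:Z).

Lemma sum_residues_inj (g : int -> int) :
  (forall x y, g x = g y %[mod q%:Z] -> x = y %[mod q%:Z])%Z ->
  \sum_(r < q) F (g r%:Z) = \sum_(r < q) F r%:Z.
Proof.
move=> g_inj; have q_neq0 : q%:Z != 0 by move: q_gt0; lia.
have h_lt (r : 'I_q) : (`|(g r%:Z %% q%:Z)%Z|%N < q)%N.
  by have := modz_ge0 (g r%:Z) q_neq0; have := ltz_mod (g r%:Z) q_neq0; lia.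
have h_eq (r : 'I_q) : Posz `|(g r%:Z %% q%:Z)%Z|%N = (g r%:Z %% q%:Z)%Z.
  by rewrite gez0_abs// modz_ge0.
pose h r : 'I_q := Ordinal (h_lt r).
have h_inj : injective h.
  move=> r1 r2 /(congr1 val)/= /(congr1 Posz); rewrite !h_eq => /g_inj.
  by rewrite !modz_small; [move=> [/val_inj]| |]; rewrite ?ltz_nat/=.
rewrite [RHS](reindex_inj h_inj); apply: eq_bigr => r _.
by rewrite /= h_eq; apply: periodic_eqmod Fq _; rewrite modz_mod.
Qed.

Lemma sum_residues_shift (s : int) :
  \sum_(r < q) F (s + r%:Z) = \sum_(r < q) F r%:Z.
Proof.
apply: (sum_residues_inj (g := fun x => s + x)) => x y.
move=> /eqz_mod_dvdP xy; apply/eqz_mod_dvdP.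
by rewrite (_ : x - y = s + x - (s + y))//; ring.
Qed.

Lemma sum_residues_mul (y : int) : coprimez y q%:Z ->
  \sum_(r < q) F (y * r%:Z) = \sum_(r < q) F r%:Z.
Proof.
move=> yq; apply: (sum_residues_inj (g := fun x => y * x)) => u v.
move=> /eqz_mod_dvdP; rewrite -mulrBr Gauss_dvdzr 1?coprimez_sym//.
by move=> /eqz_mod_dvdP.
Qed.

End ResidueSums.

(** * Dirichlet characters and Gauss sums *)

Section Characters.
Variable R : realType.
Implicit Types (chi : int -> R[i]) (q : nat).

Lemma dirichlet_character1 q chi : dirichlet_character q chi -> chi 1 = 1.
Proof.
case=> _ _ chiM chi_neq0; have /mulfI : chi 1 != 0 by rewrite chi_neq0 coprimezE coprime1n.
by apply; rewrite -chiM !mulr1.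
Qed.

Lemma dirichlet_characterX q chi x n : dirichlet_character q chi ->
  chi (x ^+ n) = chi x ^+ n.
Proof.
move=> Dchi; elim: n => [|n IHn]; first by rewrite !expr0 (dirichlet_character1 Dchi).
by case: Dchi => _ _ chiM _; rewrite !exprS chiM IHn.
Qed.

Lemma dirichlet_character_eq0 q chi x : dirichlet_character q chi ->
  ~~ coprimez x q%:Z -> chi x = 0.
Proof. by case=> _ _ _ <- /negPn/eqP. Qed.

(** Euler's theorem makes the values at units roots of unity. *)
Lemma dirichlet_character_norm1 q chi x : dirichlet_character q chi ->
  coprimez x q%:Z -> `|chi x| = 1.
Proof.
move=> Dchi xq; have [q_gt0 chiq _ _] := Dchi.
have n_gt0 : (0 < totient q * 2)%N by rewrite muln_gt0 totient_gt0 q_gt0.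
suff /(congr1 Num.norm) : chi x ^+ (totient q * 2) = 1.
  by rewrite normrX normr1 => /eqP; rewrite pexpr_eq1// => /eqP.
rewrite -(dirichlet_characterX _ _ Dchi) -(dirichlet_character1 Dchi).
apply: periodic_eqmod chiq _.
have -> : x ^+ (totient q * 2) = (`|x| ^ (totient q * 2))%N%:Z.
  by rewrite -abszX abszE ger0_norm// exprM sqr_ge0.
rewrite -[1]/(1%N%:Z) !modz_nat; congr Posz.
by rewrite expnM -modnXm Euler_exp_totient// modnXm exp1n.
Qed.

Lemma dirichlet_character0 q chi : dirichlet_character q chi -> (1 < q)%N ->
  chi 0 = 0.
Proof.
move=> Dchi q_gt1; apply: (dirichlet_character_eq0 Dchi).
by rewrite coprimezE /= /coprime gcd0n gtn_eqF.
Qed.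

Lemma dirichlet_character_mulJ q chi x : dirichlet_character q chi ->
  coprimez x q%:Z -> chi x * (chi x)^* = 1.
Proof.
by move=> Dchi xq; rewrite -sqr_normc (dirichlet_character_norm1 Dchi xq) expr1n.
Qed.

Lemma dirichlet_character_norm_le1 q chi x : dirichlet_character q chi ->
  `|chi x| <= 1.
Proof.
move=> Dchi; have [/(dirichlet_character_norm1 Dchi)->//|] := boolP (coprimez x q%:Z).
by move=> /(dirichlet_character_eq0 Dchi)->; rewrite normr0.
Qed.

Lemma nontrivial_character_gt1 q chi : dirichlet_character q chi ->
  nontrivial_character q chi -> (1 < q)%N.
Proof.
move=> Dchi [x _]; have [q_gt0 chiq _ _] := Dchi; apply: contraNT.
move=> q_le1; have q1 : q = 1%N by lia.
by rewrite -(dirichlet_character1 Dchi); apply/eqP/(periodic_eqmod chiq); rewrite q1 !modz1.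
Qed.

(** The additive character [x |-> e^(2 pi i x / q)] of the integers. *)
Definition addchar q (x : int) : R[i] := cexpi (2 * pi * x%:~R / q%:R).

Lemma addcharD q : {morph addchar q : x y / x + y >-> x * y}.
Proof.
move=> x y; rewrite /addchar /cexpi rmorphD mulrDr mulrDl cosD sinD.
by simpc; congr (_ +i* _); rewrite addrC.
Qed.

Lemma addchar0 q : addchar q 0 = 1.
Proof. by rewrite /addchar /cexpi mulr0 mul0r cos0 sin0. Qed.

Lemma addcharN q x : addchar q (- x) = (addchar q x)^*.
Proof. by rewrite /addchar /cexpi rmorphN mulrN mulNr cosN sinN. Qed.

Lemma addchar_periodic q : (0 < q)%N -> periodic (addchar q) q%:Z.
Proof.
move=> q_gt0 x; rewrite addcharD.
suff -> : addchar q q%:Z = 1 by rewrite mulr1.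
rewrite /addchar /cexpi mulfK ?pnatr_eq0 -?lt0n// mulr_natl.
by rewrite cos2pi sin2pi.
Qed.

Lemma addcharMz q k x : (0 < k)%N -> addchar (k * q) (k%:Z * x) = addchar q x.
Proof.
move=> k_gt0; rewrite /addchar; congr cexpi.
have [->|q_gt0] := posnP q; first by rewrite muln0 invr0 !mulr0.
have kR : k%:R != 0 :> R by rewrite pnatr_eq0 -lt0n.
have qR : q%:R != 0 :> R by rewrite pnatr_eq0 -lt0n.
by rewrite rmorphM natrM /=; field; rewrite kR qR.
Qed.

Lemma addchar_eqmod q x y : (0 < q)%N -> (x = y %[mod q%:Z])%Z ->
  addchar q x = addchar q y.
Proof. by move=> q_gt0; apply/periodic_eqmod/addchar_periodic. Qed.

Lemma addcharM_nat q x n : addchar q (x * n%:Z) = addchar q x ^+ n.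
Proof.
elim: n => [|n IHn]; first by rewrite mulr0 addchar0.
by rewrite exprS -IHn -addcharD; congr addchar; rewrite intS; ring.
Qed.

Definition gauss_twist q chi (l : int) : R[i] :=
  \sum_(r < q) (chi r%:Z)^* * addchar q (l * r%:Z).

Lemma gauss_twist1 q chi : gauss_twist q chi 1 = gauss_sum q (conj_character chi).
Proof. by apply: eq_bigr => r _; rewrite mul1r. Qed.

(** Substitute [r -> y r] in the sum for [l]. *)
Lemma gauss_twistM q chi l y : dirichlet_character q chi ->
  coprimez y q%:Z -> gauss_twist q chi (l * y) = chi y * gauss_twist q chi l.
Proof.
move=> Dchi yq; have [q_gt0 chiq chiM _] := Dchi.
pose F x := (chi x)^* * addchar q (l * x).
have Fq : periodic F q.
  move=> x; rewrite /F chiq; congr (_ * _).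
  by rewrite -[l * (x + _)]add0r (periodic_comp_affine _ _ (addchar_periodic q_gt0)) add0r.
rewrite [gauss_twist q chi l](esym (sum_residues_mul q_gt0 Fq yq)) mulr_sumr.
apply: eq_bigr => r _; rewrite /F chiM rmorphM /= !mulrA.
by rewrite (dirichlet_character_mulJ Dchi yq) mul1r.
Qed.

(** Adding to [x] the multiple of [d] by the product of the primes that divide
  [q] but not [x] gives an integer prime to [q] as soon as [x] is prime to [d]:
  a prime divisor of [q] divides exactly one of the two summands. *)
Definition unit_lift (q d : nat) (x : int) : int :=
  x + (\prod_(p <- primes q | ~~ (p%:Z %| x)%Z) p)%N%:Z * d%:Z.

Lemma unit_liftE q d x : (unit_lift q d x = x %[mod d%:Z])%Z.
Proof. by rewrite /unit_lift addrC modzMDl. Qed.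

Lemma coprime_unit_lift q d x : (0 < q)%N -> (d %| q)%N -> coprimez x d%:Z ->
  coprimez (unit_lift q d x) q%:Z.
Proof.
move=> q_gt0 dq xd; rewrite coprimezE /=; apply: contraT => /= Ncop.
set y := unit_lift q d x in Ncop *.
have [p p_pr /andP[py pq]] : exists2 p, prime p & (p%:Z %| y)%Z && (p %| q)%N.
  exists (pdiv (gcdn `|y| q)).
    apply: pdiv_prime; rewrite ltn_neqAle eq_sym -/(coprime _ _) Ncop.
    by rewrite gcdn_gt0 q_gt0 orbT.
  by rewrite !dvdzE/= (dvdn_trans (pdiv_dvd _) (dvdn_gcdl _ _))
             (dvdn_trans (pdiv_dvd _) (dvdn_gcdr _ _)).
have pP : p \in primes q by rewrite mem_primes p_pr q_gt0.
set k := (\prod_(p <- primes q | ~~ (p%:Z %| x)%Z) p)%N.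
have [px|Npx] := boolP (p%:Z %| x)%Z; last first.
  have pk : (p%:Z %| k%:Z)%Z by rewrite dvdzE/= /k (big_rem p)//= Npx dvdn_mulr.
  by move: py; rewrite /y /unit_lift -/k rpredDr ?dvdz_mulr// (negbTE Npx).
have : (p%:Z %| k%:Z * d%:Z)%Z by move: py; rewrite /y /unit_lift -/k rpredDl.
rewrite dvdzE abszM /= Euclid_dvdM// => /orP[|pd]; last first.
  have : (p %| gcdn `|x| d)%N by rewrite dvdn_gcd pd andbT; exact: px.
  by move: xd; rewrite coprimezE /= => /eqP->; rewrite Euclid_dvd1.
rewrite /k; suff /negP : ~~ (p %| \prod_(p <- primes q | ~~ (p%:Z %| x)%Z) p)%N by [].
rewrite Euclid_dvd_prod// big_has_cond.
apply/hasPn => r rq; apply/negP => /andP[Nrx pr].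
move: rq; rewrite mem_primes => /andP[r_pr _].
by rewrite (dvdn_prime2 p_pr r_pr) in pr; rewrite -(eqP pr) px in Nrx.
Qed.

(** The value of the new character at [x] is that of [chi] at any lift of [x] to a
  unit modulo [q]; as the choice of the lift is immaterial, products of lifts may
  serve as lifts of products. *)
Lemma induced_character q d chi : dirichlet_character q chi -> (d %| q)%N ->
  (forall x y, coprimez x q%:Z -> coprimez y q%:Z -> (x = y %[mod d%:Z])%Z ->
     chi x = chi y) ->
  exists2 psi, dirichlet_character d psi & induced_by q chi psi.
Proof.
move=> Dchi dq chid; have [q_gt0 _ chiM chi_neq0] := Dchi.
have d_gt0 : (0 < d)%N by apply: dvdn_gt0 dq.
have lift_cop x : coprimez x d%:Z -> coprimez (unit_lift q d x) q%:Z.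
  exact: coprime_unit_lift.
have cop_mod x y : (x = y %[mod d%:Z])%Z -> coprimez x d%:Z = coprimez y d%:Z.
  by move=> xy; rewrite /coprimez -gcdz_modl xy gcdz_modl.
exists (fun x => if coprimez x d%:Z then chi (unit_lift q d x) else 0); last first.
  move=> x xq; have xd : coprimez x d%:Z by apply: coprimez_dvdr xq.
  by rewrite xd; apply: chid => //; [exact: lift_cop|rewrite unit_liftE].
split=> // [x|x y|x].
- have e : (x + d%:Z = x %[mod d%:Z])%Z by rewrite modzDr.
  rewrite (cop_mod _ _ e); case: ifP => // xd.
  by apply: chid; rewrite ?unit_liftE//; apply: lift_cop; rewrite ?(cop_mod _ _ e).
- rewrite coprimezMl; have [xd/=|_] := boolP (coprimez x d%:Z); last by rewrite mul0r.
  have [yd/=|_] := boolP (coprimez y d%:Z); last by rewrite mulr0.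
  rewrite -chiM; apply: chid.
  + by apply: lift_cop; rewrite coprimezMl xd.
  + by rewrite coprimezMl !lift_cop.
  + by rewrite unit_liftE -[RHS]modzMm !unit_liftE modzMm.
- by case: ifP => [/lift_cop|]; rewrite ?eqxx// chi_neq0.
Qed.

(** For [l] prime to [q] this is a change of variable.  Otherwise the twisted sum
  depends only on [l r] modulo [q], hence on [r] modulo [q / gcd (l, q)]; if it
  did not vanish, [chi] would be induced from that smaller modulus. *)
Lemma gauss_twistE q chi l : primitive_character q chi ->
  gauss_twist q chi l = chi l * gauss_sum q (conj_character chi).
Proof.
move=> [Dchi prim]; have [q_gt0 chiq chiM _] := Dchi.
have [lq|Nlq] := boolP (coprimez l q%:Z).
  by rewrite -[l in LHS]mul1r (gauss_twistM _ Dchi lq) gauss_twist1.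
rewrite (dirichlet_character_eq0 Dchi Nlq) mul0r; apply/eqP/contraT => Gl.
pose g := gcdn `|l| q; pose d := (q %/ g)%N.
have g_gt0 : (0 < g)%N by rewrite gcdn_gt0 q_gt0 orbT.
have qE : q = (d * g)%N by rewrite divnK// dvdn_gcdr.
have d_dvd : (d %| q)%N by rewrite qE dvdn_mulr.
have d_lt : (d < q)%N.
  rewrite ltn_Pdiv// ltn_neqAle g_gt0 andbT eq_sym.
  by move: Nlq; rewrite coprimezE.
have [|psi Dpsi Ipsi] := induced_character Dchi d_dvd; last first.
  by case: (prim _ _ d_dvd d_lt Dpsi Ipsi).
move=> x y xq yq /eqz_mod_dvdP dxy; apply/(mulIf Gl).
rewrite -(gauss_twistM _ Dchi xq) -(gauss_twistM _ Dchi yq).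
apply: eq_bigr => r _; congr (_ * _); apply: addchar_eqmod => //.
apply/eqz_mod_dvdP; rewrite -mulrBl -mulrBr dvdz_mulr// qE mulnC PoszM.
by rewrite dvdz_mul// dvdzE/= dvdn_gcdl.
Qed.

Lemma sum_conj_character q chi : primitive_character q chi -> (1 < q)%N ->
  \sum_(r < q) (chi r%:Z)^* = 0.
Proof.
move=> prim q_gt1; transitivity (gauss_twist q chi 0).
  by apply: eq_bigr => r _; rewrite mul0r addchar0 mulr1.
by rewrite gauss_twistE// (dirichlet_character0 (proj1 prim))// mul0r.
Qed.

End Characters.

(** * The discrete sawtooth and its Fourier transform *)

Section Sawtooth.
Variables (R : realType) (Q : nat).
Hypothesis Q_gt0 : (0 < Q)%N.

Local Notation E := (addchar R Q).
Local Notation sin2 l := (sin (pi * l%:R / Q%:R) ^+ 2 : R).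

Let QR_neq0 : Q%:R != 0 :> R. Proof. by rewrite pnatr_eq0 -lt0n. Qed.
Let QC_neq0 : Q%:R != 0 :> R[i]. Proof. by rewrite pnatr_eq0 -lt0n. Qed.

Lemma sin2_neq0 l : (0 < l < Q)%N -> sin2 l != 0.
Proof.
move=> /andP[l_gt0 lQ]; rewrite expf_neq0// gt_eqF// sin_gt0_pi//.
rewrite divr_gt0 ?mulr_gt0 ?pi_gt0 ?ltr0n//=.
by rewrite ltr_pdivrMr ?ltr0n// ltr_pM2l ?pi_gt0// ltr_nat.
Qed.

(** The squared chord from [1] to [e^(2 i y)] is [4 sin^2 y]. *)
Lemma addchar_dist1 l : (1 - E (- l%:Z)) * (1 - E l%:Z) = (4 * sin2 l)%:C.
Proof.
rewrite addcharN /addchar /cexpi.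
have -> : 2 * pi * l%:Z%:~R / Q%:R = (pi * l%:R / Q%:R) *+ 2 :> R.
  by rewrite -[RHS]mulr_natl !mulrA.
set y := pi * _ / _; rewrite cos_mulr2n sin_mulr2n cos2sin2.
simpc; congr (_ +i* _); last by ring.
transitivity (4 * sin y ^+ 2 * (cos y ^+ 2 + sin y ^+ 2)); first by ring.
by rewrite cos2Dsin2 mulr1.
Qed.

Lemma addchar_eq1 s : (E s == 1) = (Q%:Z %| s)%Z.
Proof.
have [/dvdzP[k ->]|Ns] := boolP (Q%:Z %| s)%Z.
  by rewrite -[k * _]add0r (periodicz (@addchar_periodic R _ Q_gt0)) addchar0 eqxx.
have Q_neq0 : Q%:Z != 0 by lia.
have [l lE] : exists l, (s %% Q%:Z)%Z = Posz l.
  by have := modz_ge0 s Q_neq0; case: (s %% Q%:Z)%Z => // l _; exists l.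
have l_lt : (0 < l < Q)%N.
  rewrite -!ltz_nat -lE ltz_mod// andbT lt_def modz_ge0// andbT.
  by apply: contraNneq Ns => /dvdz_mod0P.
have -> : E s = E l%:Z by apply: addchar_eqmod => //; rewrite -lE modz_mod.
apply/eqP => E1; have /esym/eqP := addchar_dist1 l.
by rewrite E1 subrr mulr0 fmorph_eq0 mulf_eq0 pnatr_eq0 (negbTE (sin2_neq0 l_lt)).
Qed.

Lemma addcharX_modulus s : E s ^+ Q = 1.
Proof. by rewrite -addcharM_nat; apply/eqP; rewrite addchar_eq1 dvdz_mull. Qed.

Lemma sum_addchar s :
  \sum_(l < Q) E (s * l%:Z) = if (Q%:Z %| s)%Z then Q%:R else 0.
Proof.
under eq_bigr do rewrite addcharM_nat.
rewrite -addchar_eq1; have [->|E_neq1] := eqVneq (E s) 1.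
  by under eq_bigr do rewrite expr1n; rewrite sumr_const card_ord.
apply: (mulfI (_ : E s - 1 != 0)); first by rewrite subr_eq0.
by rewrite -subrX1 addcharX_modulus subrr mulr0.
Qed.

Lemma sum_addchar_delta (F : int -> R[i]) t : periodic F Q%:Z ->
  \sum_(k < Q) F k%:Z * (\sum_(l < Q) E ((t - k%:Z) * l%:Z)) = Q%:R * F t.
Proof.
move=> FQ; pose G x := F x * (if (Q%:Z %| t - x)%Z then Q%:R else 0).
have GQ : periodic G Q%:Z.
  move=> x; rewrite /G FQ opprD addrA; congr (_ * _).
  by rewrite rpredBr ?dvdzz.
transitivity (\sum_(k < Q) G k%:Z).
  by apply: eq_bigr => k _; rewrite sum_addchar.
rewrite -(sum_residues_shift Q_gt0 GQ t) (bigD1 (Ordinal Q_gt0))//= big1.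
  by rewrite addr0 /G (addr0 t) subrr dvdz0 mulrC.
move=> k k_neq0; rewrite /G opprD addrA subrr add0r.
have k_gt0 : (0 < k)%N by rewrite lt0n; apply: contraNneq k_neq0 => k0; apply/eqP/val_inj.
by rewrite dvdzE abszN/= gtnNdvd// mulr0.
Qed.

(** The value of [B1] at the midpoint of [[m/Q, (m+1)/Q]]. *)
Definition sawtooth (m : int) : R := (((m %% Q%:Z)%Z)%:~R + 2^-1) / Q%:R - 2^-1.

Lemma sawtooth_periodic : periodic sawtooth Q%:Z.
Proof. by move=> m; rewrite /sawtooth modzDr. Qed.

Lemma sawtooth_nat k : (k < Q)%N -> sawtooth k%:Z = (k%:R + 2^-1) / Q%:R - 2^-1.
Proof. by move=> kQ; rewrite /sawtooth modz_small. Qed.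

Lemma sawtooth_norm m : `|sawtooth m| <= 2^-1.
Proof.
have Q_neq0 : Q%:Z != 0 by lia.
have v_ge0 : 0 <= ((m %% Q%:Z)%Z)%:~R :> R by rewrite ler0z modz_ge0.
have v_lt : ((m %% Q%:Z)%Z)%:~R + 1 <= Q%:R :> R.
  by rewrite -(intrD _ _ 1) -[Q%:R]/(Q%:Z%:~R) ler_int lezD1 ltz_mod.
have Q0 : 0 < Q%:R :> R by rewrite ltr0n.
rewrite /sawtooth ler_norml.
have : 0 <= (((m %% Q%:Z)%Z)%:~R + 2^-1) / Q%:R :> R by rewrite divr_ge0//; lra.
have : (((m %% Q%:Z)%Z)%:~R + 2^-1) / Q%:R <= 1 :> R by rewrite ler_pdivrMr//; lra.
by move=> *; apply/andP; split; lra.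
Qed.

(** [B1] is linear on each interval between multiples of [1/Q]. *)
Lemma B1_sawtooth (m : int) (t : R) : 0 < t < 1 ->
  B1 ((m%:~R + t) / Q%:R) = sawtooth m + (t - 2^-1) / Q%:R.
Proof.
move=> /andP[t_gt0 t_lt1]; have Q_neq0 : Q%:Z != 0 by lia.
have v_ge0 : 0 <= ((m %% Q%:Z)%Z)%:~R :> R by rewrite ler0z modz_ge0.
have v_lt : ((m %% Q%:Z)%Z)%:~R + 1 <= Q%:R :> R.
  by rewrite -(intrD _ _ 1) -[Q%:R]/(Q%:Z%:~R) ler_int lezD1 ltz_mod.
have Q0 : 0 < Q%:R :> R by rewrite ltr0n.
set v : R := ((m %% Q%:Z)%Z)%:~R in v_ge0 v_lt *.
have xE : (m%:~R + t) / Q%:R = ((m %/ Q%:Z)%Z)%:~R + (v + t) / Q%:R.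
  by rewrite [in LHS](divz_eq m Q%:Z) intrD intrM -/v -[Q%:Z%:~R]/(Q%:R : R); field.
have f_gt0 : 0 < (v + t) / Q%:R by rewrite divr_gt0//; lra.
have f_lt1 : (v + t) / Q%:R < 1 by rewrite ltr_pdivrMr//; lra.
have flE : Num.floor ((m%:~R + t) / Q%:R) = (m %/ Q%:Z)%Z.
  by apply: floor_def; rewrite xE intrD; apply/andP; split; lra.
rewrite /B1 intrEfloor flE xE; case: eqP => [|_]; first by lra.
by rewrite /sawtooth -/v; field.
Qed.

Lemma B1_norm (x : R) : `|B1 x| <= 2^-1.
Proof.
rewrite /B1; case: ifP => _; first by rewrite normr0 invr_ge0.
have := floor_itv x; rewrite intrD => /andP[? ?].
by rewrite ler_norml; apply/andP; split; lra.
Qed.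

Definition sawtooth_hat (l : int) : R[i] :=
  \sum_(k < Q) (sawtooth k%:Z)%:C * E (- l * k%:Z).

Lemma sum_arith_geom (F : fieldType) (z : F) n :
  (1 - z) * \sum_(k < n) k%:R * z ^+ k = z * (\sum_(k < n) z ^+ k) - n%:R * z ^+ n.
Proof.
elim: n => [|n IHn]; first by rewrite !big_ord0 !mulr0 mul0r subr0.
by rewrite !big_ord_recr/= !mulrDr IHn exprS -natr1; ring.
Qed.

(** Multiplying by [1 - e(-l/Q)] is taking the difference of consecutive values,
  which is [1/Q] apart from the jump by [-1]. *)
Lemma sawtooth_hatE (l : int) : ~~ (Q%:Z %| l)%Z -> sawtooth_hat l * (1 - E (- l)) = -1.
Proof.
move=> Ql; have Nl : ~~ (Q%:Z %| - l)%Z by rewrite rpredN.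
have E0 : \sum_(k < Q) E (- l) ^+ k = 0.
  by under eq_bigr do rewrite -addcharM_nat; rewrite sum_addchar (negbTE Nl).
have -> : sawtooth_hat l = Q%:R^-1 * (\sum_(k < Q) k%:R * E (- l) ^+ k)
     + (2^-1 / Q%:R - 2^-1) * \sum_(k < Q) E (- l) ^+ k.
  rewrite 2!mulr_sumr -big_split; apply: eq_bigr => k _ /=.
  rewrite sawtooth_nat// addcharM_nat mulrA -mulrDl; congr (_ * _).
  by rewrite rmorphB rmorphM rmorphD !fmorphV !rmorph_nat /=; field.
rewrite E0 mulr0 addr0 mulrC mulrCA sum_arith_geom E0 mulr0 addcharX_modulus.
by field.
Qed.

Lemma sawtooth_hat_norm l : (0 < l < Q)%N ->
  sawtooth_hat l%:Z * sawtooth_hat (- l%:Z) = ((4 * sin2 l)^-1)%:C.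
Proof.
move=> l_lt; have Nl : ~~ (Q%:Z %| l%:Z)%Z by rewrite dvdzE/= gtnNdvd//; case/andP: l_lt.
have h1 := sawtooth_hatE Nl.
have := sawtooth_hatE (_ : ~~ (Q%:Z %| - l%:Z)%Z); rewrite rpredN opprK => /(_ Nl) h2.
have := addchar_dist1 l; set s := 4 * _ => sE.
have s_neq0 : s%:C != 0 :> R[i].
  by rewrite fmorph_eq0 mulf_neq0 ?pnatr_eq0// sin2_neq0.
apply: (mulIf s_neq0); rewrite -rmorphM /= mulVf ?rmorph1; last first.
  by rewrite -(fmorph_eq0 (real_complex R)).
by rewrite -sE mulrACA h1 h2 mulrNN mulr1.
Qed.

(** Parseval's identity for [Z / Q]. *)
Lemma sawtooth_correlation (s : int) :
  \sum_(k < Q) (sawtooth k%:Z * sawtooth (k%:Z + s))%:C =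
  Q%:R^-1 * \sum_(l < Q) sawtooth_hat l%:Z * sawtooth_hat (- l%:Z) * E (l%:Z * s).
Proof.
apply: (mulfI QC_neq0); rewrite mulrA divff// mul1r mulr_sumr.
pose F x := (sawtooth x)%:C.
have FQ : periodic F Q%:Z by move=> x; rewrite /F sawtooth_periodic.
transitivity (\sum_(j < Q) F j%:Z * \sum_(k < Q) F k%:Z *
    \sum_(l < Q) E ((j%:Z + s - k%:Z) * l%:Z)).
  by apply: eq_bigr => j _; rewrite (sum_addchar_delta _ FQ) rmorphM /= -/(F _) -/(F _); ring.
under eq_bigr do rewrite mulr_sumr.
under eq_bigr do under eq_bigr do rewrite !mulr_sumr.
under eq_bigr do rewrite exchange_big.
rewrite exchange_big; apply: eq_bigr => l _ /=.
rewrite exchange_big /sawtooth_hat big_distrlr/= mulr_suml; apply: eq_bigr => k _ /=.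
rewrite mulr_suml; apply: eq_bigr => j _.
have -> : (j%:Z + s - k%:Z) * l%:Z = - l%:Z * k%:Z + (- - l%:Z * j%:Z + l%:Z * s) by ring.
by rewrite !addcharD /F; ring.
Qed.

End Sawtooth.

(** * The value of [L(2, chi)] as a finite cosecant sum *)

Section Cosecant.
Variable R : realType.
Implicit Types (x y : R) (chi : int -> R[i]).

Lemma sin_le_id y : 0 <= y -> sin y <= y.
Proof.
move=> y_ge0; rewrite -subr_ge0.
pose f x : R := x - sin x.
have df x : is_derive x 1 f (1 - cos x) by rewrite /f; apply: is_deriveB.
have f_nd : {in `[0, y] &, {homo f : x z / x <= z >-> x <= z}}.
  apply: ger0_derive1_le_cc => [x _|x _|].
  - by have [] := df x.
  - by rewrite derive1E derive_val subr_ge0 cos_le1.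
  - by apply: derivable_within_continuous => x _; have [] := df x.
have := f_nd 0 y; rewrite !in_itv/= !lexx y_ge0 /f sin0 subr0.
by move=> /(_ isT isT isT).
Qed.

Lemma mul_cos_le_sin y : 0 <= y <= pi -> y * cos y <= sin y.
Proof.
move=> /andP[y_ge0 y_le]; rewrite -subr_ge0.
pose f x : R := sin x - x * cos x.
have df x : is_derive x 1 f (x * sin x).
  have -> : f = (@sin R - id * @cos R) by [].
  apply: is_derive_eq.
  by rewrite /GRing.scale/=; ring.
have f_nd : {in `[0, y] &, {homo f : x z / x <= z >-> x <= z}}.
  apply: ger0_derive1_le_cc => [x _|x|].
  - by have [] := df x.
  - rewrite in_itv/= => /andP[x_gt0 x_lt].
    rewrite derive1E derive_val mulr_ge0 1?ltW// sin_gt0_pi// x_gt0.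
    exact: lt_le_trans y_le.
  - by apply: derivable_within_continuous => x _; have [] := df x.
have := f_nd 0 y; rewrite !in_itv/= !lexx y_ge0 /f sin0 mul0r subr0.
by move=> /(_ isT isT isT).
Qed.

(** The classical inequalities [sin y <= y <= tan y]. *)
Lemma cosecant_sqr_approx y : 0 < y <= pi / 2 ->
  `|(sin y) ^- 2 - y ^- 2| <= 1.
Proof.
move=> /andP[y_gt0 y_le]; have pi_gt0 := @pi_gt0 R.
have s_gt0 : 0 < sin y by apply: sin_gt0_pi; apply/andP; split; lra.
have s_le : sin y <= y by apply/sin_le_id/ltW.
have c_ge0 : 0 <= cos y by apply: cos_ge0_pihalf; apply/andP; split; lra.
have yc_le : y * cos y <= sin y by apply: mul_cos_le_sin; apply/andP; split; lra.
have y2_gt0 : 0 < y ^+ 2 by rewrite exprn_gt0.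
have s2_gt0 : 0 < sin y ^+ 2 by rewrite exprn_gt0.
have hle : y ^- 2 <= sin y ^- 2.
  by rewrite lef_pV2 ?posrE// ler_pXn2r// nnegrE ltW.
rewrite ger0_norm ?subr_ge0// lerBlDr.
have : (y * cos y) ^+ 2 <= sin y ^+ 2.
  by rewrite ler_pXn2r// nnegrE ?mulr_ge0// ltW.
rewrite exprMn cos2sin2 => h.
rewrite -subr_ge0.
have -> : 1 + y ^- 2 - sin y ^- 2 =
    (sin y ^+ 2 - y ^+ 2 * (1 - sin y ^+ 2)) / (sin y ^+ 2 * y ^+ 2).
  by field; rewrite !gt_eqF.
by rewrite divr_ge0 ?subr_ge0// ltW// mulr_gt0.
Qed.

Definition cosecant_sum chi (P : nat) : R[i] :=
  \sum_(t < P) chi t%:Z * ((sin (pi * t%:R / P%:R) : R) ^- 2)%:C.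

Lemma cosecant_sqr_double y : sin y != 0 -> cos y != 0 ->
  sin y ^- 2 + cos y ^- 2 = 4 * sin (y *+ 2) ^- 2.
Proof.
move=> s_neq0 c_neq0; rewrite sin_mulr2n -mulr_natl.
transitivity ((cos y ^+ 2 + sin y ^+ 2) / (sin y * cos y) ^+ 2).
  by field; rewrite s_neq0 c_neq0.
by rewrite cos2Dsin2; field; rewrite s_neq0 c_neq0.
Qed.

(** The terms at [t] and [t + P] have arguments that differ by [pi / 2], so they
  combine by [1/sin^2 y + 1/cos^2 y = 4/sin^2 (2 y)]. *)
Lemma cosecant_sum_double chi P : (0 < P)%N -> chi 0 = 0 -> periodic chi P%:Z ->
  cosecant_sum chi (P + P) = 4 * cosecant_sum chi P.
Proof.
move=> P_gt0 chi0 chiP; rewrite /cosecant_sum big_split_ord /= -big_split mulr_sumr.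
apply: eq_bigr => t _ /=.
have PR : P%:R != 0 :> R by rewrite pnatr_eq0 -lt0n.
have PPR : P%:R + P%:R != 0 :> R by rewrite -natrD pnatr_eq0; lia.
rewrite PoszD [P%:Z + _]addrC chiP -mulrDr mulrCA.
have [->|t_gt0] := posnP t; first by rewrite chi0 !mul0r.
congr (_ * _); rewrite -(rmorphD (real_complex R)) -(rmorph_nat (real_complex R)) -rmorphM /=.
congr (_ %:C).
set y := pi * t%:R / (P + P)%:R.
have -> : pi * t%:R / P%:R = y *+ 2.
  by rewrite /y natrD -[RHS]mulr_natl; field; rewrite PPR.
have -> : pi * (P + t)%:R / (P + P)%:R = y + pi / 2.
  by rewrite /y !natrD; field; rewrite PPR.
have pi_gt0 := @pi_gt0 R.
have y_gt0 : 0 < y by rewrite /y divr_gt0 ?mulr_gt0 ?ltr0n ?addn_gt0 ?P_gt0.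
have y_lt : y < pi / 2.
  rewrite /y ltr_pdivrMr ?ltr0n ?addn_gt0 ?P_gt0// natrD.
  have := ltn_ord t; rewrite -(ltr_nat R) => ?; nra.
rewrite sinDpihalf; apply: cosecant_sqr_double; rewrite gt_eqF//.
- by rewrite sin_gt0_pihalf// y_gt0.
- by rewrite cos_gt0_pihalf//; apply/andP; split; lra.
Qed.

Lemma cosecant_sum_exp2 chi Q N : (0 < Q)%N -> chi 0 = 0 -> periodic chi Q%:Z ->
  cosecant_sum chi (2 ^ N * Q) = 4 ^+ N * cosecant_sum chi Q.
Proof.
move=> Q_gt0 chi0 chiQ; elim: N => [|N IHN]; first by rewrite mul1n mul1r.
rewrite expnS -mulnA mul2n -addnn cosecant_sum_double//.
- by rewrite IHN exprS mulrA.
- by rewrite muln_gt0 expn_gt0.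
- by move=> x; rewrite PoszM periodicz.
Qed.

Definition L2_term chi (k : nat) : R[i] := chi k.+1%:Z / k.+1%:R ^+ 2.

Lemma normC_real x : `|x%:C| = `|x|%:C.
Proof. by rewrite normc_def /= expr0n addr0 sqrtr_sqr. Qed.

(** Folding the sum by [t -> 2H - t] leaves arguments in [(0, pi/2]], where the
  squared cosecant is within [1] of the inverse square. *)
Lemma cosecant_sum_half chi H : (0 < H)%N -> chi 0 = 0 ->
  periodic chi (H + H)%N%:Z -> (forall l, chi (- l) = chi l) ->
  (forall l, `|chi l| <= 1) ->
  `|cosecant_sum chi (H + H)
     - (8 * H%:R ^+ 2 / pi ^+ 2)%:C * \sum_(k < H) L2_term chi k| <= 3 * H%:R.
Proof.
move=> H_gt0 chi0 chiH chiN chi1; have pi_gt0 := @pi_gt0 R.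
have pi_neq0 : @pi R != 0 by rewrite gt_eqF.
have HHR : H%:R + H%:R != 0 :> R by rewrite -natrD pnatr_eq0; lia.
pose y (t : nat) : R := pi * t%:R / (H + H)%:R.
pose c (t : nat) : R[i] := chi t%:Z * (sin (y t) ^- 2)%:C.
have cE : cosecant_sum chi (H + H) = 2 * (\sum_(i < H) c i.+1) - c H.
  rewrite /cosecant_sum big_split_ord /=.
  rewrite (_ : \sum_(i < H) _ = \sum_(i < H) c i)//.
  rewrite [X in _ + X](_ : _ = \sum_(i < H) c i.+1); last first.
    rewrite (reindex_inj rev_ord_inj); apply: eq_bigr => i _ /=.
    have iH := ltn_ord i.
    have tE : (H + (H - i.+1) = H + H - i.+1)%N by lia.
    rewrite /c tE -subzn; last by lia.
    rewrite addrC chiH chiN; congr (_ * _%:C).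
    rewrite natrB; last by lia.
    rewrite mulrBr mulrBl mulfK ?pnatr_eq0 ?addn_eq0 -?lt0n ?H_gt0//; last by lia.
    by rewrite -/(y _) sinB sinpi cospi mul0r sub0r mulN1r opprK.
  have c0 : c 0%N = 0 by rewrite /c chi0 mul0r.
  have <- : \sum_(i < H) c i + c H = \sum_(i < H) c i.+1.
    transitivity (\sum_(i < H.+1) c i); first by rewrite big_ord_recr.
    by rewrite big_ord_recl /= c0 add0r.
  by ring.
pose kap : R := 4 * H%:R ^+ 2 / pi ^+ 2.
have c_approx (i : nat) : (i < H)%N ->
    `|c i.+1 - kap%:C * L2_term chi i| <= 1.
  move=> iH.
  have -> : kap%:C * L2_term chi i = chi i.+1%:Z * (y i.+1 ^- 2)%:C.
    rewrite /L2_term mulrCA; congr (_ * _).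
    have -> : (i.+1%:R ^+ 2)^-1 = ((i.+1%:R ^+ 2)^-1)%:C :> R[i].
      by rewrite fmorphV rmorphXn rmorph_nat.
    rewrite -rmorphM; congr (_%:C).
    have i_neq0 : i.+1%:R != 0 :> R by rewrite pnatr_eq0.
    rewrite /kap /y natrD; move: i_neq0 pi_neq0 HHR.
    move: (i.+1%:R : R) (@pi R) => z p z0 p0 HHR.
    by field; rewrite HHR z0 p0.
  rewrite -mulrBr -rmorphB normrM normC_real.
  rewrite -[1]mulr1 ler_pM// ?normr_ge0 // ?ler0c ?normr_ge0//.
  rewrite -[1]/(1%:C) lecR; apply: cosecant_sqr_approx.
  rewrite /y divr_gt0 ?mulr_gt0 ?ltr0n ?addn_gt0 ?H_gt0//=.
  rewrite ler_pdivrMr ?ltr0n ?addn_gt0 ?H_gt0// natrD.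
  by have : i.+1%:R <= H%:R :> R; [rewrite ler_nat|nra].
have cH : `|c H| <= 1.
  rewrite /c; have -> : y H = pi / 2 by rewrite /y natrD; field; rewrite HHR.
  by rewrite sin_pihalf expr1n invr1 mulr1.
rewrite cE.
have -> : (8 * H%:R ^+ 2 / pi ^+ 2)%:C = 2 * kap%:C :> R[i].
  rewrite -(rmorph_nat (real_complex R)) -rmorphM; congr (_%:C).
  by rewrite /kap; ring.
rewrite -[2 * _ * _]mulrA [kap%:C * _]mulr_sumr addrAC -mulrBr -sumrB.
apply: le_trans (ler_normB _ _) _.
have sum_le : `|\sum_(i < H) (c i.+1 - kap%:C * L2_term chi i)| <= H%:R.
  apply: le_trans (ler_norm_sum _ _ _) _.
  rewrite -[H%:R]mulr1 mulr_natl -[X in _ *+ X](card_ord H) -sumr_const.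
  by apply: ler_sum => i _; apply: c_approx.
have H1 : 1 <= H%:R :> R[i] by rewrite ler1n.
rewrite normrM normr_nat [3 * _](_ : _ = 2 * H%:R + H%:R); last by ring.
by apply: lerD; [rewrite ler_pM2l ?ltr0n|exact: le_trans H1].
Qed.

End Cosecant.

Section L2Value.
Variables (R : realType) (chi : int -> R[i]).
Hypothesis chi_le1 : forall l, `|chi l| <= 1.

Lemma L2_term_norm k : `|L2_term chi k| <= (k.+1%:R ^- 2)%:C.
Proof.
rewrite /L2_term normrM normrV ?unitfE ?expf_neq0 ?pnatr_eq0// normrX normr_nat.
rewrite fmorphV rmorphXn rmorph_nat -[leRHS]mul1r ler_wpM2r//.
Qed.

(** Telescoping: [1 / k.+1 ^ 2 <= 1 / k - 1 / k.+1]. *)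
Lemma L2_term_tail n d : (0 < n)%N ->
  `|\sum_(n <= k < n + d) L2_term chi k| <= (n%:R^-1 - (n + d)%:R^-1)%:C.
Proof.
move=> n_gt0; elim: d => [|d IHd]; first by rewrite addn0 big_geq// normr0 subrr.
rewrite addnS big_nat_recr ?leq_addr//=; apply: le_trans (ler_normD _ _) _.
apply: le_trans (lerD IHd (L2_term_norm _)) _; rewrite -rmorphD lecR.
set m := (n + d)%N; have m_gt0 : 0 < m%:R :> R by rewrite ltr0n addn_gt0 n_gt0.
rewrite -natr1 -subr_ge0.
have -> : n%:R^-1 - (m%:R + 1)^-1 - (n%:R^-1 - m%:R^-1 + (m%:R + 1) ^- 2)
    = (m%:R * (m%:R + 1) ^+ 2)^-1 :> R.
  have n_neq0 : n%:R != 0 :> R by rewrite pnatr_eq0 -lt0n.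
  have m1_neq0 : m%:R + 1 != 0 :> R by rewrite gt_eqF//; lra.
  move: n_neq0 m1_neq0 (lt0r_neq0 m_gt0).
  by move: (n%:R : R) (m%:R : R) => a b a0 b1 b0; field; rewrite a0 b1 b0.
by rewrite invr_ge0 mulr_ge0 ?sqr_ge0// ltW.
Qed.

Variable Q : nat.
Hypotheses (Q_gt0 : (0 < Q)%N) (chiQ : periodic chi Q%:Z).
Hypotheses (chi0 : chi 0 = 0) (chiN : forall l, chi (- l) = chi l).

Let V : R[i] := (pi ^+ 2 / (2 * Q%:R ^+ 2))%:C * cosecant_sum chi Q.

(** The value [V] does not change when [Q] is doubled, and for the modulus
  [2 ^ n.+1 Q] the cosecant sum is within [O(2 ^ n)] of the corresponding partial
  sum multiplied by a factor of order [4 ^ n]. *)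
Lemma L2_partial_sum_exp2 n :
  `|V - \sum_(0 <= k < 2 ^ n * Q) L2_term chi k| <= (6 / n.+1%:R)%:C.
Proof.
pose H := (2 ^ n * Q)%N; rewrite -/H big_mkord.
have H_gt0 : (0 < H)%N by rewrite muln_gt0 expn_gt0.
have HH : (H + H = 2 ^ n.+1 * Q)%N by rewrite addnn -mul2n mulnA expnS.
have chiHH : periodic chi (H + H)%N%:Z by move=> x; rewrite HH PoszM periodicz.
have := cosecant_sum_half H_gt0 chi0 chiHH chiN chi_le1.
rewrite HH cosecant_sum_exp2// => bound.
have pi_gt0 := @pi_gt0 R; have pi_lt4 : pi < 4 :> R by have := @pihalf_lt2 R; lra.
have HR : 0 < H%:R :> R by rewrite ltr0n.
have QR : 0 < Q%:R :> R by rewrite ltr0n.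
pose kap : R := pi ^+ 2 / (8 * H%:R ^+ 2).
have kap_ge0 : 0 <= kap%:C by rewrite ler0c divr_ge0 ?sqr_ge0// mulr_ge0 ?sqr_ge0.
have := ler_wpM2l kap_ge0 bound.
rewrite -[X in X * `|_|](ger0_norm kap_ge0) -normrM mulrBr [kap%:C * (_ %:C * _)]mulrA.
rewrite -rmorphM [kap * _](_ : _ = 1); last first.
  have : pi != 0 :> R by rewrite gt_eqF.
  by rewrite /kap; move: (@pi R) => p p_neq0; field; rewrite p_neq0 gt_eqF.
rewrite rmorph1 mul1r [kap%:C * (4 ^+ _ * _)](_ : _ = V); last first.
  rewrite mulrA; congr (_ * _).
  rewrite -(rmorph_nat (real_complex R) 4) -rmorphXn -rmorphM; congr (_%:C).
  have HE : 4 * H%:R ^+ 2 = 4 ^+ n.+1 * Q%:R ^+ 2 :> R.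
    rewrite /H natrM exprMn natrX exprAC (_ : 2 ^+ 2 = 4) ?exprS ?mulrA//; last by ring.
  rewrite /kap (_ : 8 * H%:R ^+ 2 = 2 * (4 * H%:R ^+ 2)); last by ring.
  rewrite HE; have : 4 ^+ n.+1 != 0 :> R by rewrite expf_neq0 ?pnatr_eq0.
  by move: (4 ^+ n.+1 : R) => z z_neq0; field; rewrite z_neq0 gt_eqF.
move=> /le_trans; apply.
have -> : 3 * H%:R = (3 * H%:R)%:C :> R[i].
  by rewrite (rmorphM (real_complex R)) !(rmorph_nat (real_complex R)).
rewrite -rmorphM lecR.
have nH : n.+1%:R <= H%:R :> R.
  by rewrite ler_nat; apply: leq_trans (ltn_expl n (ltnSn 1)) _; rewrite leq_pmulr.
have n_gt0 : 0 < n.+1%:R :> R by rewrite ltr0n.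
apply: le_trans (_ : 6 / H%:R <= _); last by rewrite ler_wpM2l// lef_pV2.
have -> : kap * (3 * H%:R) = (3 / 8 * pi ^+ 2) / H%:R.
  by rewrite /kap; move: (@pi R) => p; field; rewrite gt_eqF.
by rewrite ler_wpM2r ?invr_ge0 ?ltW//; nra.
Qed.

Lemma L2_partial_sum n :
  `|V - \sum_(0 <= k < n.+1) L2_term chi k| <= (7 / n.+1%:R)%:C.
Proof.
have le_n : (n.+1 <= 2 ^ n * Q)%N.
  by apply: leq_trans (ltn_expl n (ltnSn 1)) _; rewrite leq_pmulr.
have := L2_partial_sum_exp2 n; rewrite (big_cat_nat _ le_n)//= => h1.
have := @L2_term_tail n.+1 (2 ^ n * Q - n.+1) isT; rewrite subnKC// => h2.
set S := \sum_(0 <= k < n.+1) _ in h1 *; set T := \sum_(n.+1 <= k < _) _ in h1 h2.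
have -> : V - S = V - (S + T) + T by ring.
apply: le_trans (ler_normD _ _) _; apply: le_trans (lerD h1 h2) _.
rewrite -rmorphD lecR.
have : 0 <= (2 ^ n * Q)%:R^-1 :> R by rewrite invr_ge0.
have -> : 7 / n.+1%:R = 6 / n.+1%:R + n.+1%:R^-1 :> R by ring.
by move=> h; rewrite lerD2l gerBl.
Qed.

Lemma cvg_L2 : series (L2_term chi : nat -> R[i]^o) @ \oo --> (V : R[i]^o).
Proof.
apply/cvgrPdist_le => e e_gt0.
have [r r_gt0 eE] : exists2 r : R, 0 < r & e = r%:C.
  have /complex_realP[r eE] := gtr0_real e_gt0.
  by exists r => //; rewrite -ltcR -eE.
near=> n; rewrite eE.
have n_gt0 : (0 < n)%N by near: n; exists 1%N.
have rn : 7 / r <= n%:R by near: n; exact: nbhs_infty_ger.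
have := L2_partial_sum n.-1; rewrite prednK// => /le_trans; apply.
rewrite lecR ler_pdivrMr ?ltr0n// mulrC -ler_pdivrMr//.
Unshelve. all: by end_near. Qed.

End L2Value.

(** The product character is even, vanishes at [0] and has period [q1 q2], which is
  all that the evaluation by cosecants needs; limits for the complex norm are
  unique. *)
Lemma L2E (R : realType) (q1 q2 : nat) (chi1 chi2 : int -> R[i]) :
  dirichlet_character q1 chi1 -> dirichlet_character q2 chi2 -> (1 < q1)%N ->
  chi1 (-1) * chi2 (-1) = 1 ->
  L2 chi1 chi2 = (pi ^+ 2 / (2 * (q1 * q2)%:R ^+ 2))%:C *
    cosecant_sum (fun l => chi1 l * chi2 l) (q1 * q2).
Proof.
move=> D1 D2 q1_gt1 even12.
have [q1_gt0 chi1q chi1M _] := D1; have [q2_gt0 chi2q chi2M _] := D2.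
apply: (@cvg_lim R[i]^o); first exact: norm_hausdorff.
apply: cvg_L2.
- move=> l; rewrite normrM mulr_ile1//.
    exact: dirichlet_character_norm_le1 D1.
  exact: dirichlet_character_norm_le1 D2.
- by rewrite muln_gt0 q1_gt0.
- by move=> l; rewrite PoszM {1}[q1%:Z * _]mulrC periodicz// periodicz.
- by rewrite (dirichlet_character0 D1 q1_gt1) mul0r.
- by move=> l; rewrite -mulN1r chi1M chi2M mulrACA even12 mul1r.
Qed.

(** * Periodic functions against slowly varying weights *)

Section AbelSummation.
Variable F : numFieldType.

Lemma sum_blocks (V : nmodType) (f : nat -> V) Q N :
  \sum_(j < Q * N) f j = \sum_(k < Q) \sum_(i < N) f (k * N + i)%N.
Proof.
elim: Q => [|Q IHQ]; first by rewrite mul0n !big_ord0.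
by rewrite mulSnr big_split_ord big_ord_recr /= IHQ.
Qed.

Lemma summation_by_parts (h g : nat -> F) N :
  \sum_(i < N) h i * g i = (\sum_(i < N) h i) * g N
    - \sum_(i < N) (\sum_(k < i.+1) h k) * (g i.+1 - g i).
Proof.
elim: N => [|N IHN]; first by rewrite !big_ord0 mul0r subr0.
by rewrite !big_ord_recr /= IHN; ring.
Qed.

Lemma norm_sum_ord_le (f : nat -> F) (M : F) n : (forall i, (i < n)%N -> `|f i| <= M) ->
  `|\sum_(i < n) f i| <= n%:R * M.
Proof.
move=> fM; apply: le_trans (ler_norm_sum _ _ _) _.
rewrite mulr_natl -[X in _ *+ X](card_ord n) -sumr_const.
by apply: ler_sum => i _; apply: fM.
Qed.

(** Complete periods contribute nothing, so only fewer than [q] terms remain. *)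
Lemma norm_sum_periodic_le (h : int -> F) (q : nat) (M : F) n :
  (0 < q)%N -> periodic h q%:Z -> \sum_(r < q) h r%:Z = 0 -> (forall x, `|h x| <= M) ->
  `|\sum_(i < n) h i%:Z| <= q%:R * M.
Proof.
move=> q_gt0 hq h0 hM; have M_ge0 : 0 <= M by apply: le_trans (hM 0).
rewrite (divn_eq n q) big_split_ord /= (sum_blocks (fun i => h i%:Z)).
rewrite big1 ?add0r => [|k _]; last first.
  rewrite -[RHS]h0; apply: eq_bigr => r _.
  by rewrite PoszD PoszM addrC periodicz.
apply: le_trans (_ : (n %% q)%:R * M <= _).
  apply: (norm_sum_ord_le (f := fun i => h (_ + i)%N%:Z)) => i _; exact: hM.
by rewrite ler_wpM2r// ler_nat ltnW// ltn_mod.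
Qed.

(** Replacing a periodic factor by its mean costs a bounded amount: the partial
  sums of the difference are bounded, and the weight has bounded variation. *)
Lemma sum_periodic_mean (h : int -> F) (g : nat -> F) (q : nat) (M G : F) N :
  (0 < q)%N -> periodic h q%:Z -> (forall x, `|h x| <= M) ->
  (forall i, (i <= N)%N -> `|g i| <= G) ->
  (forall i, `|g i.+1 - g i| <= N%:R^-1) ->
  `|\sum_(i < N) h i%:Z * g i
     - (q%:R^-1 * \sum_(r < q) h r%:Z) * \sum_(i < N) g i|
    <= q%:R * (M + M) * (G + 1).
Proof.
move=> q_gt0 hq hM gG dg; have qF : q%:R != 0 :> F by rewrite pnatr_eq0 -lt0n.
set mu := _ * (\sum_(r < q) _).
have mu_le : `|mu| <= M.
  rewrite /mu normrM normfV normr_nat ler_pdivrMl ?ltr0n//.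
  by apply: (norm_sum_ord_le (f := fun i => h i%:Z)).
pose h0 x := h x - mu.
have h0M x : `|h0 x| <= M + M by apply: le_trans (ler_normB _ _) _; apply: lerD.
have h0q : periodic h0 q%:Z by move=> x; rewrite /h0 hq.
have h0_sum : \sum_(r < q) h0 r%:Z = 0.
  by rewrite sumrB sumr_const card_ord -mulr_natl /mu mulrA divff// mul1r subrr.
have W n : `|\sum_(i < n) h0 i%:Z| <= q%:R * (M + M) by exact: norm_sum_periodic_le.
have W_ge0 : 0 <= q%:R * (M + M) by apply: le_trans (W 0%N).
rewrite mulr_sumr -sumrB.
under eq_bigr do rewrite -mulrBl.
rewrite (summation_by_parts (fun i => h0 i%:Z)) mulrDr mulr1.
apply: le_trans (ler_normB _ _) _; apply: lerD.
  by rewrite normrM ler_pM ?gG//; apply: W.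
have [->|N_gt0] := posnP N; first by rewrite big_ord0 normr0.
have NF : N%:R != 0 :> F by rewrite pnatr_eq0 -lt0n.
rewrite -[leRHS](mulVKf NF).
apply: (norm_sum_ord_le (f := fun i => (\sum_(k < i.+1) h0 k%:Z) * (g i.+1 - g i))) => i _.
by rewrite normrM mulrC ler_pM.
Qed.

End AbelSummation.

(** * Block decomposition of the Dedekind sum *)

Section DedekindBlocks.
Variables (R : realType) (q1 q2 N : nat) (chi1 chi2 : int -> R[i]) (n : int).
Hypotheses (prim1 : primitive_character q1 chi1) (prim2 : primitive_character q2 chi2).
Hypotheses (q1_gt1 : (1 < q1)%N) (N_gt0 : (0 < N)%N).

Local Notation Q := (q1 * q2)%N.
Local Notation saw := (sawtooth R Q).
Local Notation a := (1 + n * (q1 * N)%N%:Z).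
Local Notation D1 := (proj1 prim1).
Local Notation D2 := (proj1 prim2).

Let q1_gt0 : (0 < q1)%N. Proof. exact: ltnW. Qed.
Let q2_gt0 : (0 < q2)%N. Proof. by case: D2. Qed.
Let Q_gt0 : (0 < Q)%N. Proof. by rewrite muln_gt0 q1_gt0. Qed.

Let q1_neq0 : q1%:R != 0 :> R. Proof. by rewrite pnatr_eq0 -lt0n. Qed.
Let q2_neq0 : q2%:R != 0 :> R. Proof. by rewrite pnatr_eq0 -lt0n. Qed.
Let N_neq0 : N%:R != 0 :> R. Proof. by rewrite pnatr_eq0 -lt0n. Qed.

(** In the sum of [conj chi1 (s) B1 (x + s / q1)] over [s] modulo [q1] the linear
  parts of [B1] cancel, which leaves a step function of [x]; [step_value m] is its
  value for [m / Q < x < (m + 1) / Q]. *)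
Definition step_value (m : int) : R[i] :=
  \sum_(s < q1) (chi1 s%:Z)^* * (saw (m + q2%:Z * s%:Z))%:C.

Lemma step_value_periodic : periodic step_value Q%:Z.
Proof.
move=> m; apply: eq_bigr => s _.
by rewrite addrAC (sawtooth_periodic R Q).
Qed.

Lemma step_value_norm m : `|step_value m| <= q1%:R.
Proof.
rewrite -[leRHS]mulr1 /step_value.
apply: (norm_sum_ord_le (f := fun s => (chi1 s%:Z)^* * (saw (m + q2%:Z * s%:Z))%:C)) => s _.
rewrite normrM mulr_ile1//.
  by rewrite normcJ; exact: dirichlet_character_norm_le1 D1.
by rewrite normC_real -[leRHS]/(1%:C) lecR; apply: le_trans (sawtooth_norm R Q_gt0 _) _; lra.
Qed.

Definition dedekind_summand (j : nat) : R[i] :=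
  \sum_(s < q1) (chi2 j%:Z)^* * (chi1 s%:Z)^* *
    (B1 (j%:R / (Q * N)%:R : R) * B1 (s%:R / q1%:R + a%:~R * j%:R / (Q * N)%:R : R))%:C.

Lemma dedekind_summand_norm j : `|dedekind_summand j| <= q1%:R.
Proof.
rewrite -[leRHS]mulr1 /dedekind_summand.
apply: (norm_sum_ord_le (f := fun s => (chi2 j%:Z)^* * (chi1 s%:Z)^* *
    (B1 (j%:R / (Q * N)%:R : R) *
     B1 (s%:R / q1%:R + a%:~R * j%:R / (Q * N)%:R : R))%:C)) => s _.
have B (x : R) : `|B1 x| <= 1 by apply: le_trans (B1_norm x) _; lra.
rewrite normrM mulr_ile1//.
  rewrite normrM !normcJ mulr_ile1// ?(dirichlet_character_norm_le1 _ D1)//.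
  exact: dirichlet_character_norm_le1 D2.
by rewrite normC_real -[leRHS]/(1%:C) lecR normrM mulr_ile1.
Qed.

(** On the [k]-th block [[k N, (k + 1) N)], with [k < Q], the first factor [B1(j/c)]
  is for [j <> 0] the linear function [block_weight k], while the product of
  [conj chi2] with the step function has period [q2]. *)
Definition block_weight (k i : nat) : R := saw k%:Z + (i%:R / N%:R - 2^-1) / Q%:R.

Definition block_char (k : nat) (x : int) : R[i] :=
  (chi2 ((k * N)%N%:Z + x))^* * step_value (k%:Z + q1%:Z * n * ((k * N)%N%:Z + x)).

Lemma dedekind_summand_interior k i : (0 < i < N)%N ->
  dedekind_summand (k * N + i) = block_char k i%:Z * (block_weight k i)%:C.
Proof.
move=> /andP[i_gt0 iN].
pose t : R := i%:R / N%:R.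
have t01 : 0 < t < 1 by rewrite /t divr_gt0 ?ltr0n//= ltr_pdivrMr ?ltr0n// mul1r ltr_nat.
have xE : (k * N + i)%:R / (Q * N)%:R = (k%:Z%:~R + t) / Q%:R :> R.
  by rewrite /t -[k%:Z%:~R]/(k%:R : R) natrD !natrM; field; rewrite q1_neq0 q2_neq0 N_neq0.
have yE s : s%:R / q1%:R + a%:~R * (k * N + i)%:R / (Q * N)%:R =
    ((k%:Z + q1%:Z * n * ((k * N)%N%:Z + i%:Z) + q2%:Z * s%:Z)%:~R + t) / Q%:R :> R.
  rewrite /t !intrD !intrM !intrD -[k%:Z%:~R]/(k%:R : R) -[q1%:Z%:~R]/(q1%:R : R)
    -[q2%:Z%:~R]/(q2%:R : R) -[s%:Z%:~R]/(s%:R : R) -[i%:Z%:~R]/(i%:R : R)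
    -[(k * N)%N%:Z%:~R]/((k * N)%:R : R) -[(q1 * N)%N%:Z%:~R]/((q1 * N)%:R : R).
  rewrite natrD !natrM -[1%:~R]/(1 : R).
  by field; rewrite q1_neq0 q2_neq0 N_neq0.
rewrite /dedekind_summand xE (B1_sawtooth Q_gt0 _ t01) -/(block_weight k i).
under eq_bigr do rewrite yE (B1_sawtooth Q_gt0 _ t01) -PoszD.
rewrite /block_char -PoszD; set m := k%:Z + _; set rho := (t - 2^-1) / Q%:R.
have -> : step_value m = \sum_(s < q1) (chi1 s%:Z)^* * (saw (m + q2%:Z * s%:Z) + rho)%:C.
  under [RHS]eq_bigr do rewrite rmorphD mulrDr.
  by rewrite big_split /= -[X in _ + X]mulr_suml (sum_conj_character prim1 q1_gt1) mul0r addr0.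
rewrite mulr_sumr mulr_suml; apply: eq_bigr => s _.
by rewrite rmorphM /=; ring.
Qed.

Lemma block_char_periodic k : periodic (block_char k) q2%:Z.
Proof.
have [_ chi2q _ _] := D2.
move=> x; rewrite /block_char addrA chi2q; congr (_ * _).
rewrite [q1%:Z * n * (_ + q2%:Z)](_ : _ = q1%:Z * n * ((k * N)%N%:Z + x) + n * Q%:Z).
  by rewrite addrA periodicz//; exact: step_value_periodic.
by rewrite PoszM; ring.
Qed.

Lemma block_char_norm k x : `|block_char k x| <= q1%:R.
Proof.
rewrite /block_char normrM normcJ -[leRHS]mul1r ler_pM ?step_value_norm//.
exact: dirichlet_character_norm_le1 D2.
Qed.

Lemma block_weight_norm k i : (i <= N)%N -> `|(block_weight k i)%:C| <= 1.
Proof.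
move=> iN; rewrite normC_real -[leRHS]/(1%:C) lecR.
have QR : 1 <= Q%:R :> R by rewrite ler1n.
have NR : 0 < N%:R :> R by rewrite ltr0n.
apply: le_trans (ler_normD _ _) _; rewrite [leRHS](_ : 1 = 2^-1 + 2^-1); last by field.
rewrite lerD ?sawtooth_norm// normrM normfV normr_nat ler_pdivrMr; last by lra.
apply: le_trans (_ : 2^-1 <= _); last by lra.
have : 0 <= i%:R / N%:R :> R by rewrite divr_ge0.
have : i%:R / N%:R <= 1 :> R by rewrite ler_pdivrMr// mul1r ler_nat.
by rewrite ler_norml => *; apply/andP; split; lra.
Qed.

Lemma block_weight_step k i :
  `|(block_weight k i.+1)%:C - (block_weight k i)%:C| <= N%:R^-1.
Proof.
rewrite -rmorphB normC_real.
have -> : N%:R^-1 = (N%:R^-1)%:C :> R[i] by rewrite fmorphV rmorph_nat.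
have NR : 0 < N%:R :> R by rewrite ltr0n.
have QR : 1 <= Q%:R :> R by rewrite ler1n.
have -> : block_weight k i.+1 - block_weight k i = N%:R^-1 / Q%:R.
  by rewrite /block_weight -natr1; field; rewrite q2_neq0 q1_neq0 N_neq0.
have Q0 : 0 < Q%:R :> R by lra.
rewrite lecR ger0_norm; last by rewrite divr_ge0 ?invr_ge0.
by rewrite ler_pdivrMr// ler_peMr// invr_ge0.
Qed.

Lemma sum_block_weight k :
  \sum_(i < N) (block_weight k i)%:C = (N%:R * saw k%:Z - 2^-1 / Q%:R)%:C.
Proof.
rewrite -rmorph_sum; congr (_%:C).
suff S m : \sum_(i < m) block_weight k i =
    m%:R * saw k%:Z + (m%:R * (m%:R - 1) / (2 * N%:R) - m%:R / 2) / Q%:R.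
  by rewrite S; field; rewrite q2_neq0 q1_neq0 N_neq0.
elim: m => [|m IHm]; first by rewrite big_ord0; field; rewrite q2_neq0 q1_neq0 N_neq0.
by rewrite big_ord_recr /= IHm /block_weight -natr1; field; rewrite q2_neq0 q1_neq0 N_neq0.
Qed.

Definition dedekind_mean : R[i] :=
  \sum_(k < Q) (saw k%:Z)%:C *
    \sum_(r < q2) (chi2 r%:Z)^* * step_value (k%:Z + q1%:Z * n * r%:Z).

Lemma sum_block_char k : \sum_(r < q2) block_char k r%:Z =
  \sum_(r < q2) (chi2 r%:Z)^* * step_value (k%:Z + q1%:Z * n * r%:Z).
Proof.
have [_ chi2q _ _] := D2.
pose F (x : int) := (chi2 x)^* * step_value (k%:Z + q1%:Z * n * x).
have Fq : periodic F q2%:Z.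
  move=> x; rewrite /F chi2q; congr (_ * _).
  rewrite [q1%:Z * n * (x + _)](_ : _ = q1%:Z * n * x + n * Q%:Z).
    by rewrite addrA periodicz//; exact: step_value_periodic.
  by rewrite PoszM; ring.
exact: (sum_residues_shift q2_gt0 Fq (k * N)%N%:Z).
Qed.

(** On the [k]-th of [Q] blocks of length [N] the summand is, but for its first
  term, a [q2]-periodic function times a linear one. *)
Lemma dedekind_block_approx k :
  `|\sum_(i < N) dedekind_summand (k * N + i)
    - N%:R / q2%:R * ((saw k%:Z)%:C *
       \sum_(r < q2) (chi2 r%:Z)^* * step_value (k%:Z + q1%:Z * n * r%:Z))|
    <= (7 * Q)%N%:R.
Proof.
rewrite -sum_block_char.
(* Only at [i = 0] can [B1] be evaluated at a multiple of [1/Q], where it may jump. *)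
have edge : `|\sum_(i < N) dedekind_summand (k * N + i)
     - \sum_(i < N) block_char k i%:Z * (block_weight k i)%:C| <= q1%:R + q1%:R.
  rewrite -sumrB (bigD1 (Ordinal N_gt0))//= big1 ?addr0 => [|i i_neq0]; last first.
    rewrite dedekind_summand_interior ?subrr// ltn_ord andbT lt0n.
    by apply: contraNneq i_neq0 => i0; apply/eqP/val_inj.
  apply: le_trans (ler_normB _ _) _; apply: lerD; first exact: dedekind_summand_norm.
  rewrite normrM -[leRHS]mulr1 ler_pM ?block_char_norm//.
  exact: block_weight_norm.
have := @sum_periodic_mean _ (block_char k) (fun i => (block_weight k i)%:C) q2 q1%:R 1 N
  q2_gt0 (block_char_periodic k) (block_char_norm k)
  (@block_weight_norm k) (block_weight_step k).
set P := \sum_(i < N) block_char _ _ * _ in edge *.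
set B := \sum_(r < q2) block_char _ _; rewrite sum_block_weight => mean.
have B_le : `|q2%:R^-1 * B| <= q1%:R.
  rewrite normrM normfV normr_nat ler_pdivrMl ?ltr0n//.
  by apply: (norm_sum_ord_le (f := fun i => block_char k i%:Z)) => i _; apply: block_char_norm.
set S := \sum_(i < N) _ in edge *.
(* The weights add up to [N saw k - 1/(2Q)] instead of [N saw k]: the points of the
   block are not symmetric about its midpoint. *)
have -> : S - N%:R / q2%:R * ((saw k%:Z)%:C * B) = (S - P)
    + (P - q2%:R^-1 * B * (N%:R * saw k%:Z - 2^-1 / Q%:R)%:C)
    + - (q2%:R^-1 * B * (2^-1 / Q%:R)%:C).
  move: (saw k%:Z) => z.
  by rewrite rmorphB (rmorphM (real_complex R)) (rmorph_nat (real_complex R)) /=; ring.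
apply: le_trans (ler_normD _ _) _; rewrite normrN.
have last_le : `|q2%:R^-1 * B * (2^-1 / Q%:R)%:C| <= q1%:R.
  rewrite normrM -[leRHS]mulr1 ler_pM// normC_real -[leRHS]/(1%:C) lecR.
  have QR : 1 <= Q%:R :> R by rewrite ler1n.
  by rewrite normrM normfV normr_nat ger0_norm// ler_pdivrMr; lra.
apply: le_trans (lerD (le_trans (ler_normD _ _) (lerD edge mean)) last_le) _.
have -> : q1%:R + q1%:R + q2%:R * (q1%:R + q1%:R) * (1 + 1) + q1%:R
   = (q1 + q1 + q2 * (q1 + q1) * 2 + q1)%N%:R :> R[i].
  by rewrite !natrD !natrM !natrD.
by rewrite ler_nat; have := leq_pmulr q1 q2_gt0; nia.
Qed.

Lemma dedekind_sum_approx :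
  `|dedekind_sum q1 chi1 chi2 a (Q * N) - N%:R / q2%:R * dedekind_mean|
    <= (Q * (7 * Q))%N%:R.
Proof.
have -> : dedekind_sum q1 chi1 chi2 a (Q * N) =
    \sum_(k < Q) \sum_(i < N) dedekind_summand (k * N + i).
  exact: (sum_blocks dedekind_summand).
rewrite /dedekind_mean mulr_sumr -sumrB natrM.
apply: (norm_sum_ord_le (f := fun k => \sum_(i < N) dedekind_summand (k * N + i)
    - N%:R / q2%:R * ((saw k%:Z)%:C *
       \sum_(r < q2) (chi2 r%:Z)^* * step_value (k%:Z + q1%:Z * n * r%:Z)))) => k _.
exact: dedekind_block_approx.
Qed.

(** Each frequency [l] of the correlation of the sawtooth with itself is
  multiplied by a twisted Gauss sum for either character. *)
Lemma dedekind_meanE : dedekind_mean =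
  gauss_sum q1 (conj_character chi1) * gauss_sum q2 (conj_character chi2) * chi2 n
    / (4 * Q%:R) * cosecant_sum (fun l => chi1 l * chi2 l) Q.
Proof.
have [_ _ chi2M _] := D2.
transitivity (\sum_(r < q2) \sum_(s < q1) (chi2 r%:Z)^* * (chi1 s%:Z)^* *
    \sum_(k < Q) (saw k%:Z * saw (k%:Z + (q1%:Z * n * r%:Z + q2%:Z * s%:Z)))%:C).
  rewrite /dedekind_mean; under eq_bigr do rewrite mulr_sumr.
  rewrite exchange_big; apply: eq_bigr => r _ /=.
  under eq_bigr do rewrite !mulr_sumr.
  rewrite exchange_big; apply: eq_bigr => s _ /=.
  rewrite mulr_sumr; apply: eq_bigr => k _.
  by rewrite addrA rmorphM /=; ring.
pose w (l : nat) := sawtooth_hat R Q l%:Z * sawtooth_hat R Q (- l%:Z).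
transitivity (Q%:R^-1 * \sum_(l < Q) w l *
    (gauss_twist q2 chi2 (n * l%:Z) * gauss_twist q1 chi1 l%:Z)).
  under eq_bigr do under eq_bigr do
    rewrite (sawtooth_correlation _ Q_gt0) mulrCA mulr_sumr.
  under eq_bigr do rewrite -mulr_sumr.
  rewrite -mulr_sumr; congr (_ * _).
  under eq_bigr do rewrite exchange_big.
  rewrite exchange_big; apply: eq_bigr => l _ /=.
  rewrite /gauss_twist [X in _ = _ * X]big_distrlr/= [RHS]mulr_sumr.
  apply: eq_bigr => r _.
  rewrite [RHS]mulr_sumr; apply: eq_bigr => s _.
  rewrite mulrDr addcharD.
  rewrite (_ : l%:Z * (q1%:Z * n * r%:Z) = q1%:Z * (n * l%:Z * r%:Z)); last by ring.
  rewrite (_ : l%:Z * (q2%:Z * s%:Z) = q2%:Z * (l%:Z * s%:Z)); last by ring.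
  rewrite addcharMz// [X in addchar R X (q2%:Z * _)]mulnC addcharMz//.
  by rewrite /w; ring.
rewrite /cosecant_sum [LHS]mulr_sumr [RHS]mulr_sumr; apply: eq_bigr => l _.
rewrite !gauss_twistE// chi2M.
have [->|l_gt0] := posnP l; first by rewrite (dirichlet_character0 D1 q1_gt1) !(mul0r, mulr0).
have l_lt : (0 < l < Q)%N by rewrite l_gt0 ltn_ord.
have inv4 (z : R) : ((4 * z)^-1)%:C = 4^-1 * (z^-1)%:C :> R[i].
  by rewrite invfM (rmorphM (real_complex R)) (fmorphV (real_complex R))
    (rmorph_nat (real_complex R)).
rewrite /w (sawtooth_hat_norm _ Q_gt0 l_lt) inv4.
have QC : Q%:R != 0 :> R[i] by rewrite pnatr_eq0 -lt0n.
move: (_^-1%:C) (Q%:R : R[i]) QC => z x x_neq0.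
by field.
Qed.

End DedekindBlocks.

(** * The main term *)

(** From [a d = 1] modulo [c] follows [n d = m] modulo [q2], so both halves of
  the bracket in [beta] carry the same factor [chi2 n], and
  [(1 + i) - (1 - i) = 2 i]. *)
Lemma beta_bracket (R : realType) (q2 : nat) (chi2 : int -> R[i]) (c' m n : int) :
  dirichlet_character q2 chi2 -> c' != 0 ->
  ((1 + n * c') * (1 - m * c') = 1 %[mod c' * q2%:Z])%Z ->
  (1 + 'i%R) * chi2 n - (1 - 'i%R) * chi2 m * (chi2 (1 - m * c'))^* = 2 * 'i%R * chi2 n.
Proof.
move=> D2 c'_neq0 /eqz_mod_dvdP/dvdzP[t tE]; have [_ chi2q chi2M _] := D2.
have dq : coprimez (1 - m * c') q2%:Z.
  apply/coprimezP; exists (1 + n * c', - t * c'); rewrite /=.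
  by move: tE; nia.
have nE : n * (1 - m * c') - t * q2%:Z = m.
  by apply: (mulIf c'_neq0); move: tE; nia.
rewrite -[_ * chi2 m * _]mulrA.
have -> : chi2 m * (chi2 (1 - m * c'))^* = chi2 n.
  rewrite -{1}nE -(mulNr t) (periodicz chi2q) chi2M -mulrA.
  by rewrite (dirichlet_character_mulJ D2 dq) mulr1.
by ring.
Qed.
Theorem theorem1p5 (R : realType) (q1 q2 : nat) :
  exists K : R, forall chi1 chi2 : int -> R[i],
    primitive_character q1 chi1 -> nontrivial_character q1 chi1 ->
    primitive_character q2 chi2 -> nontrivial_character q2 chi2 ->
    chi1 (-1) * chi2 (-1) = 1 ->
    forall c : nat, (0 < c)%N -> (q1 * q2 %| c)%N ->
    let c' := (c %/ q2)%N in
    forall m n a d : int,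
    a = 1 + n * c'%:Z -> d = 1 - m * c'%:Z -> (a * d = 1 %[mod c%:Z])%Z ->
    `| dedekind_sum q1 chi1 chi2 a c - beta q1 q2 chi1 chi2 m n d * c'%:R |
      <= (K * ln (c'%:R : R))%:C.
Proof.
(* The error is bounded by [7 Q ^ 2]; as [c' >= q1 >= 2], dividing by [ln 2] turns
   this into a multiple of [ln c']. *)
set Q := (q1 * q2)%N; exists ((Q * (7 * Q))%:R / ln 2).
move=> chi1 chi2 prim1 nontriv1 prim2 _ even12 c c_gt0 /dvdnP[N cE] c' m n a d aE dE ad1.
have [D1 _] := prim1; have [D2 _] := prim2.
have q1_gt1 := nontrivial_character_gt1 D1 nontriv1.
have q2_gt0 : (0 < q2)%N by case: D2.
have N_gt0 : (0 < N)%N by move: c_gt0; rewrite cE muln_gt0 => /andP[].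
have c'E : c' = (q1 * N)%N by rewrite /c' cE mulnA mulnK// mulnC.
have c'_gt1 : (1 < c')%N by rewrite c'E; nia.
have cE' : c = (Q * N)%N by rewrite cE mulnC.
have bracket : (1 + 'i%R) * chi2 n - (1 - 'i%R) * chi2 m * (chi2 d)^* = 2 * 'i%R * chi2 n.
  rewrite dE; apply: beta_bracket D2 _ _; first by lia.
  rewrite -aE -dE (_ : c'%:Z * q2%:Z = c%:Z)//.
  by rewrite c'E cE' /Q -PoszM; congr Posz; ring.
have main : beta q1 q2 chi1 chi2 m n d * c'%:R
    = N%:R / q2%:R * dedekind_mean q1 q2 chi1 chi2 n.
  rewrite (dedekind_meanE n prim1 prim2 q1_gt1) /beta bracket.
  rewrite (L2E D1 D2 q1_gt1 even12) c'E.
  have q1R : q1%:R != 0 :> R[i] by rewrite pnatr_eq0 -lt0n ltnW.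
  have q2R : q2%:R != 0 :> R[i] by rewrite pnatr_eq0 -lt0n.
  have pi_neq0 : (@pi R)%:C != 0 by rewrite fmorph_eq0 gt_eqF ?pi_gt0.
  have i_neq0 : 'i%R != 0 :> R[i] by exact: neq0Ci.
  have e1 (p : R) : (4 * p ^+ 2)%:C = 4 * p%:C ^+ 2 :> R[i].
    by rewrite (rmorphM (real_complex R)) rmorphXn (rmorph_nat (real_complex R)).
  have e2 (p x : R) : (p ^+ 2 / (2 * x ^+ 2))%:C = p%:C ^+ 2 / (2 * x%:C ^+ 2) :> R[i].
    by rewrite (rmorphM (real_complex R)) fmorphV (rmorphM (real_complex R) 2) !rmorphXn
      (rmorph_nat (real_complex R)).
  rewrite e1 e2 (rmorph_nat (real_complex R)) !natrM.
  move: (cosecant_sum _ _) (gauss_sum _ _) (gauss_sum q2 _) (chi2 n) => T g1 g2 x.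
  move: ('i%R) ((@pi R)%:C) i_neq0 pi_neq0 => i p i_neq0 p_neq0.
  by field; rewrite q2R q1R i_neq0 p_neq0.
rewrite main cE' aE c'E.
apply: le_trans (dedekind_sum_approx n prim1 prim2 q1_gt1 N_gt0) _.
rewrite -(rmorph_nat (real_complex R)) lecR -c'E -/Q.
have ln2_gt0 : 0 < ln 2 :> R by rewrite ln_gt0// ltr1n.
rewrite mulrAC ler_pdivlMr// ler_wpM2l//.
by rewrite ler_ln ?posrE ?ltr0n ?ler_nat// ltnW.
Qed.
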